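(* Let $A,V\in\mathbb{R}^{d\times d}$ be symmetric positive definite, $b\in\mathbb{R}^d$, $\theta\in[0,1]$ and $h>0$, such that the spectral radius of $(I+\tfrac{\theta h}2VA)^{-1}(I-\tfrac{(1-\theta)h}2VA)$ is less than $1$. The general Langevin proposal $$y=(I+\tfrac{\theta h}{2}VA)^{-1}\Big[(I-\tfrac{(1-\theta)h}{2}VA)x+\tfrac h2Vb+(hV)^{1/2}\xi\Big],\qquad \xi\sim N(0,I),$$ corresponds to the matrix splitting $\mathcal{A}=M-N$ with vector $\beta$ given by $$M=\tfrac2hV^{-1/2}W(I+\tfrac{\theta h}2B)V^{-1/2},\qquad \mathcal{A}=V^{-1/2}WBV^{-1/2}=\tilde WA,$$ $$N=\tfrac2hV^{-1/2}W(I-\tfrac{(1-\theta)h}2B)V^{-1/2},\qquad \beta=V^{-1/2}WV^{1/2}b=\tilde Wb,$$ where $B=V^{1/2}AV^{1/2}$, $W=I+(\theta-\tfrac12)\tfrac h2B$ and $\tilde W=I+(\theta-\tfrac12)\tfrac h2AV$.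
   Context: $N(m,C)$ is the normal distribution with mean $m$ and covariance $C$; $V^{1/2}$ is the symmetric positive definite square root. An AR(1) proposal $y=Gx+g+\nu$, $\nu\sim N(0,\Sigma)$, is said to correspond to the matrix splitting $\mathcal{A}=M-N$ with vector $\beta$ if $M$ is invertible, $G=M^{-1}N$, $g=M^{-1}\beta$ and $\Sigma=M^{-1}(M^T+N)M^{-T}$; equivalently, $y$ is given by $My=Nx+\beta+\nu'$ with $\nu'\sim N(0,M^T+N)$. *)

(* Defs.v *)
From HB Require Import structures.
From mathcomp Require Import all_boot all_order all_algebra.
From mathcomp Require Import complex.
From mathcomp Require Import all_classical all_reals all_analysis.

Set Implicit Arguments.
Unset Strict Implicit.
Unset Printing Implicit Defensive.

Import Order.TTheory GRing.Theory Num.Theory.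
Local Open Scope classical_set_scope.
Local Open Scope ring_scope.

Section Matrices.
Variables (R : realType) (d : nat).
Implicit Types A S V G : 'M[R]_d.

Definition qform A (u : 'cV[R]_d) : R := (u^T *m A *m u) ord0 ord0.

Definition sympsd A : Prop := A^T = A /\ forall u, 0 <= qform A u.

Definition symposdef A : Prop := A^T = A /\ forall u, u != 0 -> 0 < qform A u.

(* V^{1/2}: the symmetric positive definite S with S S = V, which exists and is
   unique when V is symmetric positive definite (0 if there is no such S). *)
Definition mxsqrt V : 'M[R]_d := xget 0 [set S | symposdef S /\ S *m S = V].

(* V^{-1/2} *)
Definition mxisqrt V : 'M[R]_d := invmx (mxsqrt V).

(* Largest modulus of the complex eigenvalues of a real matrix. *)
Definition spectral_radius G : R :=
  sup [set Normc.normc z | z in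
        [set z : complex R | eigenvalue (map_mx (real_complex R) G) z]].

End Matrices.

Section Gaussian.
Context (R : realType) (disp : measure_display) (T : measurableType disp).
Variable P : probability T R.

(* The normal law on the real line with mean m and variance v >= 0; the point
   mass at m when v = 0.  The second argument of normal_prob is the standard
   deviation, and normal_prob m 0 is not the point mass. *)
Definition normal1 (m v : R) (E : set R) : \bar R :=
  if v == 0 then dirac m E else normal_prob m (Num.sqrt v) E.

Definition normal_rv (Y : T -> R) (m v : R) : Prop :=
  measurable_fun setT Y /\
  forall E : set R, measurable E -> P (Y @^-1` E) = normal1 m v E.

(* X ~ N(m, C) for a random vector X of R^d: C is a covariance matrix, and every
   linear functional <t, X> is N(<t, m>, <t, C t>) on the real line. *)
Definition normal_rvec (d : nat) (X : T -> 'cV[R]_d)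
    (m : 'cV[R]_d) (C : 'M[R]_d) : Prop :=
  sympsd C /\
  forall t : 'cV[R]_d,
    normal_rv (fun w => (t^T *m X w) ord0 ord0)
              ((t^T *m m) ord0 ord0) (qform C t).

(* y = G x + g + nu with nu ~ N(0, Sigma).  A proposal y maps the current state
   x and the outcome w to the proposed state y x w. *)
Definition AR1_proposal (d : nat) (y : 'cV[R]_d -> T -> 'cV[R]_d)
    (G : 'M[R]_d) (g : 'cV[R]_d) (Sigma : 'M[R]_d) : Prop :=
  exists nu : T -> 'cV[R]_d,
    normal_rvec nu 0 Sigma /\ forall x w, y x w = G *m x + g + nu w.

Definition corresponds_to_splitting (d : nat) (y : 'cV[R]_d -> T -> 'cV[R]_d)
    (calA M N : 'M[R]_d) (beta : 'cV[R]_d) : Prop :=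
  exists (G : 'M[R]_d) (g : 'cV[R]_d) (Sigma : 'M[R]_d),
    AR1_proposal y G g Sigma /\
    calA = M - N /\
    M \in unitmx /\
    G = invmx M *m N /\
    g = invmx M *m beta /\
    Sigma = invmx M *m (M^T + N) *m (invmx M)^T.

Definition langevin_proposal (d : nat) (A V : 'M[R]_d) (b : 'cV[R]_d)
    (theta h : R) (xi : T -> 'cV[R]_d) (x : 'cV[R]_d) (w : T) : 'cV[R]_d :=
  invmx (1%:M + (theta * h / 2) *: (V *m A)) *m
    ((1%:M - ((1 - theta) * h / 2) *: (V *m A)) *m x
     + (h / 2) *: (V *m b) + mxsqrt (h *: V) *m xi w).

End Gaussian.

(* Main.v *)
Require Import Defs.
From HB Require Import structures.
From mathcomp Require Import all_boot all_order all_algebra.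
From mathcomp Require Import complex.
From mathcomp Require Import all_classical all_reals all_analysis.
From mathcomp Require Import ring.

Import Order.TTheory GRing.Theory Num.Theory.
Local Open Scope classical_set_scope.
Local Open Scope ring_scope.

Set Implicit Arguments.
Unset Strict Implicit.

(** Write S = V^{1/2}, so that V A = S B S^-1, and put
    D = I + (theta h / 2) B and E = I - ((1 - theta) h / 2) B.
    These and W are polynomials in the symmetric matrix B, and
      D + E = 2 W,   D - E = (h / 2) B.
    The second identity gives calA = M - N.  The first one gives
    M + N = (4 / h) S^-1 W^2 S^-1, and since M is symmetric with inverse
    (h / 2) S D^-1 W^-1 S, the factors W cancel everywhere:
      M^-1 N = S D^-1 E S^-1,   M^-1 beta = (h / 2) S D^-1 S b,
      M^-1 (M^T + N) M^-T = h S D^-2 S.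
    Conjugating by S, these are the iteration matrix, the drift and the
    covariance of the Langevin proposal, whose noise is K (h V)^{1/2} xi with
    K = (I + (theta h / 2) V A)^-1 = S D^-1 S^-1; a linear image of a standard
    normal vector is normal (normal_rvec_linear).

    Two facts make M invertible.  D is positive definite because B is and
    theta >= 0.  As for W, if v W = 0 with v != 0 then v E = - v D by the first
    identity, so v D S^-1 is a row eigenvector of the iteration matrix for the
    eigenvalue -1, and its spectral radius is at least 1
    (spectral_radius_ge): the spectral condition excludes exactly this.

    That V^{1/2} has its defining properties (mxsqrtP) requires the existence of
    a positive definite square root.  The spectral theorem is applied over the
    complex numbers; the root is brought back to the reals by taking it to be
    a real polynomial in V. *)

(** * Quadratic forms and positive definite square roots *)

Lemma poly_interpolation (F : fieldType) (f : F -> F) (s : seq F) :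
  exists p : {poly F}, {in s, forall x, p.[x] = f x}.
Proof.
elim: s => [|a s [p ps]]; first by exists 0.
have [as_|as_] := boolP (a \in s).
  by exists p => x /[!inE] /orP[/eqP->|]; apply: ps.
pose q := \prod_(y <- s) ('X - y%:P).
have qa : q.[a] != 0 by rewrite -[_ == 0]/(root q a) root_prod_XsubC.
exists (p + ((f a - p.[a]) / q.[a]) *: q) => x /[!inE] /orP[/eqP->|xs].
  by rewrite !hornerE divfK// addrC subrK.
have /eqP qx : root q x by rewrite root_prod_XsubC.
by rewrite !hornerE qx mulr0 addr0 ps.
Qed.

Section QuadraticForms.
Context {R : realType} {d : nat}.
Implicit Types (A S : 'M[R]_d) (u : 'cV[R]_d).

Lemma qform1_ge0 u : 0 <= qform 1%:M u.
Proof.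
by rewrite /qform mulmx1 mxE sumr_ge0// => i _; rewrite mxE -expr2 sqr_ge0.
Qed.

Lemma qform1_gt0 u : u != 0 -> 0 < qform 1%:M u.
Proof.
move=> u0; rewrite lt_neqAle qform1_ge0 andbT eq_sym.
apply: contra u0; rewrite /qform mulmx1 mxE psumr_eq0; last first.
  by move=> i _; rewrite mxE -expr2 sqr_ge0.
move=> /allP uu; apply/eqP/colP => i; rewrite mxE.
have := uu i; rewrite mem_index_enum => /(_ isT).
by rewrite /= mxE mulf_eq0 orbb => /eqP.
Qed.

Lemma qform_congr (S A : 'M[R]_d) u :
  qform (S^T *m A *m S) u = qform A (S *m u).
Proof. by rewrite /qform trmx_mul !mulmxA. Qed.

Lemma qformD A S u : qform (A + S) u = qform A u + qform S u.
Proof. by rewrite /qform mulmxDr mulmxDl mxE. Qed.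

Lemma qformZ a A u : qform (a *: A) u = a * qform A u.
Proof. by rewrite /qform -scalemxAr -scalemxAl mxE. Qed.

Lemma symposdef_ge0 A u : symposdef A -> 0 <= qform A u.
Proof.
move=> [_ A0]; have [->|/A0/ltW//] := eqVneq u 0.
by rewrite /qform trmx0 !mul0mx mxE.
Qed.

Lemma symposdef_unit A : symposdef A -> A \in unitmx.
Proof.
move=> [AT A0]; rewrite unitmxE unitfE; apply/negP => /det0P[v v0 vA].
have /A0 : v^T != 0 by rewrite -(inj_eq trmx_inj) trmxK trmx0.
by rewrite /qform trmxK vA mul0mx mxE ltxx.
Qed.

(** This is how the square root S of V is shown to be positive definite: S is
    itself the square of a symmetric fourth root of V. *)
Lemma symposdef_sqr A : A^T = A -> A \in unitmx -> symposdef (A *m A).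
Proof.
move=> AT Au; split; first by rewrite trmx_mul AT.
move=> u u0; rewrite -{1}AT -[A^T]mulmx1 qform_congr qform1_gt0//.
by apply: contra u0 => /eqP Au0; rewrite -(mulKmx Au u) Au0 mulmx0.
Qed.

Lemma symposdefZ a A : 0 < a -> symposdef A -> symposdef (a *: A).
Proof.
move=> a0 [AT A0]; split=> [|u /A0]; first by rewrite linearZ/= AT.
by rewrite qformZ; apply: mulr_gt0.
Qed.

End QuadraticForms.

(** Real form of the spectral theorem: s lists the eigenvalues of V, and V is
    killed by any polynomial vanishing on them because V is diagonalizable over
    the complex numbers.  Phrased with real polynomials only, so that identities
    between real polynomials in V can be checked on positive numbers. *)
Lemma symposdef_annihilator (R : realType) (n : nat) (V : 'M[R]_n.+1) :
  symposdef V -> exists s : seq R, {in s, forall x, 0 < x} /\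
    forall p : {poly R}, {in s, forall x, p.[x] = 0} -> horner_mx V p = 0.
Proof.
move=> [VT V0].
pose f := real_complex R : {rmorphism R -> complex R}.
pose VC := map_mx f V; pose D := spectral_diag VC; pose P := spectralmx VC.
have VCh : VC \is hermsymmx.
  apply: realsym_hermsym.
    by apply/is_hermitianmxP; rewrite expr0 scale1r map_mx_id// /VC map_trmx VT.
  by apply/mxOverP => i j; rewrite mxE; apply/Creal_ImP; rewrite -complexIm.
have VCe : VC = invmx P *m diag_mx D *m P.
  exact/orthomx_spectralP/hermitian_normalmx.
have Pu : P \in unitmx by exact: spectral_unit.
have Df i : D 0 i = f (complex.Re (D 0 i)).
  have := hermitian_spectral_diag_real VCh.
  by move=> /mxOverP/(_ 0 i)/RRe_real/esym.
exists [seq complex.Re (D 0 i) | i : 'I_n.+1]; split.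
  move=> _ /mapP[i _ ->].
  (* A real eigenvalue of the complexified matrix has a real eigenvector, on
     which the quadratic form of V is positive. *)
  have : eigenvalue V (complex.Re (D 0 i)).
    rewrite -(eigenvalue_map f) -Df -/VC; apply/eigenvalueP; exists (row i P).
      rewrite VCe !mulmxA -row_mul mulmxV// row1 -rowE row_diag_mx.
      by rewrite -scalemxAl -rowE.
    apply/eqP => Pi0; have : row i (P *m invmx P) 0 i = 0.
      by rewrite row_mul Pi0 mul0mx mxE.
    by rewrite mulmxV// !mxE eqxx => /eqP; rewrite oner_eq0.
  move=> /eigenvalueP[v vV v0].
  have vT0 : v^T != 0 by rewrite -(inj_eq trmx_inj) trmxK trmx0.
  have := V0 _ vT0.
  rewrite /qform trmxK vV -scalemxAl mxE pmulr_lgt0//.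
  by have := qform1_gt0 vT0; rewrite /qform trmxK mulmx1.
move=> p ps; apply: (map_mx_inj (f := f)); rewrite map_horner_mx -/VC VCe.
rewrite horner_mx_uconjC// horner_mx_diag raddf0.
suff -> : map_mx (horner (map_poly f p)) D = 0 by rewrite linear0 mulmx0 mul0mx.
apply/rowP => i; rewrite !mxE Df horner_map/= ps ?rmorph0//.
by apply: map_f; rewrite mem_enum.
Qed.

Lemma trmx_horner_mx (R : comNzRingType) (n : nat) (V : 'M[R]_n.+1) p :
  (horner_mx V p)^T = horner_mx V^T p.
Proof.
elim/poly_ind: p => [|p c IH]; first by rewrite !rmorph0 trmx0.
rewrite !rmorphD !rmorphM /= !horner_mx_X !horner_mx_C linearD /=.
rewrite trmx_mul IH tr_scalar_mx; congr (_ + _).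
exact: comm_mx_horner.
Qed.

(** With q interpolating the fourth root on the eigenvalues of V, the matrix
    q(V) is symmetric and q(V)^4 = V, so q(V)^2 is the root; a polynomial
    interpolating the square root would not show positivity as directly. *)
Lemma symposdef_sqrt_ex (R : realType) (d : nat) (V : 'M[R]_d) :
  symposdef V -> exists S : 'M[R]_d, symposdef S /\ S *m S = V.
Proof.
case: d V => [|n] V Vp.
  (* Polynomials in a matrix need a positive dimension. *)
  by exists V; split=> //; rewrite [LHS]flatmx0 [RHS]flatmx0.
have [s [s0 sV]] := symposdef_annihilator Vp.
have [q qs] := poly_interpolation (fun x => Num.sqrt (Num.sqrt x)) s.
pose Q := horner_mx V q.
have Q4 : (Q *m Q) *m (Q *m Q) = V.
  apply/eqP; rewrite -subr_eq0 -[X in _ - X]horner_mx_X !mulmxE.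
  rewrite -!rmorphM -rmorphB; apply/eqP/sV => x xs.
  rewrite hornerD hornerN hornerX !hornerM qs// -!expr2.
  rewrite !sqr_sqrtr ?sqrtr_ge0 ?subrr//.
exact: ltW (s0 _ xs).
exists (Q *m Q); split=> //; apply: symposdef_sqr.
  by rewrite /Q trmx_horner_mx (proj1 Vp).
by have := symposdef_unit Vp; rewrite -Q4 !unitmx_mul => /andP[/andP[]].
Qed.

Lemma mxsqrtP (R : realType) (d : nat) (V : 'M[R]_d) :
  symposdef V -> symposdef (mxsqrt V) /\ mxsqrt V *m mxsqrt V = V.
Proof. by move=> /symposdef_sqrt_ex; exact: xgetPex. Qed.

(** * Spectral radius and normal vectors *)

(** The supremum defining the spectral radius is meaningful because the
    eigenvalues, being roots of the characteristic polynomial, are finitely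
    many; the sum of the moduli of these roots is an upper bound. *)
Lemma spectral_radius_ge (R : realType) (d : nat) (G : 'M[R]_d) (a : R) :
  eigenvalue G a -> `|a| <= spectral_radius G.
Proof.
move=> Ga.
have -> : `|a| = Normc.normc (real_complex R a).
  by rewrite /= expr0n addr0 sqrtr_sqr.
apply: ub_le_sup; last first.
  by exists (real_complex R a) => //=; rewrite eigenvalue_map.
set p := char_poly (map_mx (real_complex R) G).
have [r rp] := closed_field_poly_normal p.
exists (\sum_(z <- r) Normc.normc z) => _ [z /= Gz <-].
have normc_ge0 (w : complex R) : 0 <= Normc.normc w.
  by case: w => x y; exact: sqrtr_ge0.
have zr : z \in r.
  move: Gz; rewrite eigenvalue_root_char -/p rp rootZ ?root_prod_XsubC//.
  by rewrite lead_coef_eq0 monic_neq0// char_poly_monic.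
by rewrite (big_rem z)//= lerDl sumr_ge0.
Qed.

(** A functional t of L X is the functional L^T t of X, whose variance is
    <L^T t, L^T t> = <t, L L^T t>. *)
Lemma normal_rvec_linear (R : realType) (disp : measure_display)
    (T : measurableType disp) (P : probability T R) (d : nat)
    (X : T -> 'cV[R]_d) (L : 'M[R]_d) :
  normal_rvec P X 0 1%:M -> normal_rvec P (fun w => L *m X w) 0 (L *m L^T).
Proof.
move=> [_ hX].
have qL u : qform (L *m L^T) u = qform 1%:M (L^T *m u).
  by rewrite -qform_congr mulmx1 trmxK.
split; first split.
- by rewrite trmx_mul trmxK.
- by move=> u; rewrite qL qform1_ge0.
- move=> t; have := hX (L^T *m t).
  rewrite -qL !mulmx0 trmx_mul trmxK.
  by under eq_fun do rewrite -mulmxA.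
Qed.

(** * The Langevin proposal as a matrix splitting *)

Lemma mulmx1_invmx (R : comUnitRingType) (n : nat) (X Y : 'M[R]_n) :
  X *m Y = 1%:M -> invmx X = Y.
Proof.
by move=> XY; have [Xu _] := mulmx1_unit XY; rewrite -[LHS]mulmx1 -XY mulKmx.
Qed.

Theorem theorem5p3 (R : realType) (d : nat) (A V : 'M[R]_d) (b : 'cV[R]_d)
    (theta h : R)
    (hA : symposdef A) (hV : symposdef V)
    (htheta : 0 <= theta <= 1) (hh : 0 < h)
    (hrho : spectral_radius
              (invmx (1%:M + (theta * h / 2) *: (V *m A)) *m
               (1%:M - ((1 - theta) * h / 2) *: (V *m A))) < 1)
    (disp : measure_display) (T : measurableType disp) (P : probability T R)
    (xi : T -> 'cV[R]_d) (hxi : normal_rvec P xi 0 1%:M) :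
  let B : 'M[R]_d := mxsqrt V *m A *m mxsqrt V in
  let W : 'M[R]_d := 1%:M + ((theta - 2^-1) * (h / 2)) *: B in
  let Wt : 'M[R]_d := 1%:M + ((theta - 2^-1) * (h / 2)) *: (A *m V) in
  let M : 'M[R]_d :=
    (2 / h) *: (mxisqrt V *m W *m (1%:M + (theta * h / 2) *: B) *m mxisqrt V) in
  let N : 'M[R]_d :=
    (2 / h) *: (mxisqrt V *m W *m (1%:M - ((1 - theta) * h / 2) *: B)
                *m mxisqrt V) in
  let calA : 'M[R]_d := mxisqrt V *m W *m B *m mxisqrt V in
  let beta : 'cV[R]_d := mxisqrt V *m W *m mxsqrt V *m b in
  corresponds_to_splitting P (langevin_proposal A V b theta h xi) calA M N beta
  /\ calA = Wt *m A
  /\ beta = Wt *m b.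
Proof.
have [theta0 _] := andP htheta; have h0 : h != 0 := lt0r_neq0 hh.
have [Spd SS] := mxsqrtP hV; have [ST _] := Spd.
have Su := symposdef_unit Spd.
pose S := mxsqrt V; rewrite -/S in SS Spd ST Su.
move=> B W Wt M N calA beta.
have BT : B^T = B by rewrite /B -/S !trmx_mul ST (proj1 hA) mulmxA.
pose D := 1%:M + (theta * h / 2) *: B.
pose E := 1%:M - ((1 - theta) * h / 2) *: B.
have DW : D *m W = W *m D.
  have DB : D *m B = B *m D.
    by rewrite /D mulmxDl mulmxDr mul1mx mulmx1 -scalemxAl -scalemxAr.
  by rewrite /W mulmxDr mulmxDl mulmx1 mul1mx -scalemxAr -scalemxAl DB.
have DEW : D + E = 2 *: W.
  by apply/matrixP => i j; rewrite !mxE; field.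
have DEB : D - E = (h / 2) *: B.
  by apply/matrixP => i j; rewrite !mxE; field.
have DT : D^T = D by rewrite linearD linearZ /= BT trmx1.
have WT : W^T = W by rewrite linearD linearZ /= BT trmx1.
have Du : D \in unitmx.
  apply: symposdef_unit; split=> // u u0.
  rewrite qformD qformZ ltr_pwDl ?qform1_gt0// mulr_ge0//.
    by rewrite divr_ge0// mulr_ge0// ltW.
  by rewrite /B -/S -{1}ST qform_congr symposdef_ge0.
(* V A = S B S^-1, hence the same similarity for affine functions of them. *)
have simV a : 1%:M + a *: (V *m A) = S *m (1%:M + a *: B) *m invmx S.
  rewrite mulmxDr mulmxDl mulmx1 mulmxV//; congr (_ + _).
  by rewrite -scalemxAr -scalemxAl /B -/S -SS !mulmxA mulmxK.
have simD : 1%:M + (theta * h / 2) *: (V *m A) = S *m D *m invmx S.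
  exact: simV.
have simE : 1%:M - ((1 - theta) * h / 2) *: (V *m A) = S *m E *m invmx S.
  by rewrite -scaleNr simV scaleNr.
have invD : invmx (S *m D *m invmx S) = S *m invmx D *m invmx S.
  by apply: mulmx1_invmx; rewrite !mulmxA (mulmxKV Su) (mulmxK Du) mulmxV.
have Wu : W \in unitmx.
  rewrite unitmxE unitfE; apply/negP => /det0P[v v0 vW].
  have vE : v *m E = - (v *m D).
    apply/eqP; rewrite -addr_eq0 addrC -mulmxDr DEW -scalemxAr vW scaler0//.
  (* The row v D S^-1 is mapped to v E S^-1 = - v D S^-1. *)
  have : eigenvalue (invmx (S *m D *m invmx S) *m (S *m E *m invmx S)) (- 1).
    rewrite invD; apply/eigenvalueP; exists (v *m D *m invmx S); last first.
      apply: contra v0 => /eqP e.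
      by rewrite -(mulmxK Du v) -(mulmxKV Su (v *m D)) e !mul0mx.
    by rewrite !mulmxA !(mulmxKV Su) (mulmxK Du) vE scaleN1r mulNmx.
  move/spectral_radius_ge; rewrite -simD -simE normrN1 leNgt hrho//.
have ME : M = (2 / h) *: (invmx S *m W *m D *m invmx S) by [].
have NE : N = (2 / h) *: (invmx S *m W *m E *m invmx S) by [].
have calAE : calA = invmx S *m W *m B *m invmx S by [].
have betaE : beta = invmx S *m W *m S *m b by [].
have hinv : 2 / h * (h / 2) = 1 by field.
pose L := (h / 2) *: (S *m invmx D *m invmx W *m S).
have ML : M *m L = 1%:M.
  rewrite ME /L -scalemxAl -scalemxAr scalerA hinv scale1r !mulmxA.
  by rewrite (mulmxKV Su) (mulmxK Du) (mulmxK Wu) mulVmx.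
have [Mu _] := mulmx1_unit ML.
have invM := mulmx1_invmx ML.
have LT : L^T = (h / 2) *: (S *m invmx W *m invmx D *m S).
  by rewrite linearZ /= !trmx_mul !trmx_inv ST DT WT !mulmxA.
have MT : M^T = M.
  by rewrite ME linearZ /= !trmx_mul !trmx_inv ST DT WT !mulmxA -(mulmxA _ D) DW
    !mulmxA.
have MN : M + N = (4 / h) *: (invmx S *m W *m W *m invmx S).
  rewrite ME NE -scalerDr -mulmxDl -mulmxDr DEW -scalemxAr -scalemxAl scalerA.
  by congr (_ *: _); field.
(* S^-1 W^2 S^-1 meets L on the left and L^T on the right, which cancels W. *)
have SigmaE : L *m (M^T + N) *m L^T = h *: (S *m invmx D *m invmx D *m S).
  rewrite MT MN LT /L -!scalemxAl -!scalemxAr -!scalemxAl !scalerA !mulmxA.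
  rewrite (mulmxK Su) (mulmxKV Wu) (mulmxKV Su) (mulmxK Wu).
  by congr (_ *: _); field.
have WS : invmx S *m W = Wt *m invmx S.
  rewrite /W /Wt mulmxDr mulmxDl mulmx1 mul1mx; congr (_ + _).
  by rewrite -scalemxAr -scalemxAl /B -/S -SS !mulmxA mulVmx// mul1mx mulmxK.
split; last split.
- exists (invmx M *m N), (invmx M *m beta),
    (invmx M *m (M^T + N) *m (invmx M)^T).
  split; last first.
    split; last by [].
    rewrite calAE ME NE -scalerBr -mulmxBl -mulmxBr DEB.
    by rewrite -scalemxAr -scalemxAl scalerA hinv scale1r.
  pose K := S *m invmx D *m invmx S.
  exists (fun w => K *m mxsqrt (h *: V) *m xi w); split.
    have [[QT _] QQ] := mxsqrtP (symposdefZ hh hV).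
    suff -> : invmx M *m (M^T + N) *m (invmx M)^T =
        (K *m mxsqrt (h *: V)) *m (K *m mxsqrt (h *: V))^T.
      exact: normal_rvec_linear.
    rewrite invM SigmaE trmx_mul QT !mulmxA -(mulmxA K) QQ -SS.
    rewrite /K !trmx_mul !trmx_inv ST DT -scalemxAr -scalemxAl !mulmxA.
    by rewrite (mulmxKV Su) (mulmxK Su).
  move=> x w; rewrite /langevin_proposal simD simE invD -/K 2!mulmxDr.
  congr (_ + _ + _); last by rewrite mulmxA.
    rewrite invM /L NE -scalemxAl -scalemxAr scalerA [_ * (2 / h)]mulrC.
    rewrite hinv scale1r /K !mulmxA.
    by rewrite (mulmxK Su) (mulmxKV Wu) (mulmxKV Su).
  rewrite invM /L betaE -scalemxAl -scalemxAr /K -SS !mulmxA.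
  by rewrite (mulmxKV Su) (mulmxK Su) (mulmxKV Wu).
- by rewrite calAE WS /B -/S !mulmxA (mulmxKV Su) (mulmxK Su).
- by rewrite betaE WS (mulmxKV Su).
Qed.
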